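(* Let $X,H,K,J$ satisfy the basic assumptions (i)–(iv) of the context, and let $g$, $u^\dagger$, $D$, $\Phi$, $\Psi$ satisfy the variational inequality assumption (VI) of the context. For $\delta>0$ and $g^\delta\in H$ with $\|g-g^\delta\|\le\delta$, let $\{u_n^\delta\}_{n\ge1}$ be generated by the augmented Lagrangian method described in the context, with step sizes $\tau_k>0$ and $t_n=\sum_{k=1}^n\tau_k\to\infty$. Then there exists a constant $C>0$ (independent of $n$, $\delta$ and $g^\delta$) such that $$D(u_n^\delta,u^\dagger)\le C\,t_n\left(\Psi\left(\frac{16}{t_n}\right)+\delta^2\right)\qquad\text{and}\qquad \|Ku_n^\delta-g^\delta\|^2\le C\left(\Psi\left(\frac{16}{t_n}\right)+\delta^2\right)$$ for all $n\ge 1$. In particular, if $n=n(\delta)$ is chosen such that $t_n\asymp \frac{1}{\Psi^{-1}(\delta^2)}$ (i.e. the quotient of the two sides is bounded above and below by positive constants independent of $\delta$), then, as $\delta\to0$, $$D(u_n^\delta,u^\dagger)=\mathcal{O}\left(\frac{\delta^2}{\Psi^{-1}(\delta^2)}\right)\qquad\text{and}\qquad \|Ku_n^\delta-g\|^2=\mathcal{O}(\delta^2).$$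
   Context: Basic assumptions: (i) $X$ is a separable Banach space with dual $X^*$, and $H$ is a Hilbert space (identified with its dual). (ii) $K\colon X\to H$ is linear and continuous. (iii) $J\colon X\to\mathbb{R}\cup\{+\infty\}$ is convex, lower semicontinuous and proper, with nonempty domain $D(J)=\{u\in X: J(u)<\infty\}$. (iv) For each $h\in H$ and $c>0$ the set $\{u\in X:\|Ku-h\|^2+J(u)\le c\}$ is sequentially weakly pre-compact in $X$ (every sequence in it has a subsequence converging weakly in $X$). Exact problem: given $g\in H$, consider $\inf_{u\in X}J(u)$ subject to $Ku=g$. A solution is $u^\dagger\in X$ with $Ku^\dagger=g$, $J(u^\dagger)<\infty$ and $J(u^\dagger)\le J(u)$ for all $u$ with $Ku=g$. Augmented Lagrangian method (ALM): given $g^\delta\in H$, an initial value $p_0^\delta\in H$ and positive parameters $\{\tau_k\}_{k\in\mathbb{N}}$ with $t_n:=\sum_{k=1}^n\tau_k\to\infty$, compute for $k=1,2,\dots$ $$u_k^\delta\in\operatorname{argmin}_{u\in X}\Bigl[\frac{\tau_k}{2}\|Ku-g^\delta\|^2+J(u)-\langle p_{k-1}^\delta,Ku-g^\delta\rangle\Bigr],\qquad p_k^\delta=p_{k-1}^\delta+\tau_k(g^\delta-Ku_k^\delta).$$ Variational inequality assumption (VI): $\Phi\colon[0,\infty)\to[0,\infty)$ is an index function, i.e. continuous, strictly increasing and concave with $\Phi(0)=0$. $D\colon X\times X\to[0,\infty]$ satisfies $D(u,u)=0$ for all $u\in X$, and $u^\dagger$ is a solution of the exact problem such that $$D(u,u^\dagger)\le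 J(u)-J(u^\dagger)+\Phi(\|Ku-g\|^2)\qquad\text{for all }u\in X.$$ $\Psi$ is the Legendre–Fenchel conjugate of $\Phi^{-1}$, i.e. $\Psi(s)=\sup_{t\ge0}[st-\Phi^{-1}(t)]$ (with $\Phi^{-1}=+\infty$ outside the range of $\Phi$), and $\Psi^{-1}$ is the inverse function of $\Psi$.
   Formalization: The initial values are required to satisfy ‖p_0^δ‖ ≤ B for a fixed B, where either B = 0 or Φ(t) ≥ c√t near 0 for some c > 0; C and the O-constants may depend on B. For arbitrary p_0^δ the claim fails (e.g. K = id, J = D = 0, Φ(t) = t, τ_k = 16, g^δ = g = 0, p_0 ≠ 0). *)

(* Defs.v *)
From HB Require Import structures.
From mathcomp Require Import all_boot all_order all_algebra.
From mathcomp Require Import all_classical all_reals all_analysis.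
Set Implicit Arguments.
Unset Strict Implicit.
Unset Printing Implicit Defensive.
Import Order.TTheory GRing.Theory Num.Theory.
Import numFieldNormedType.Exports.
Local Open Scope classical_set_scope.
Local Open Scope ring_scope.
Local Open Scope ereal_scope.

Section Spaces.
Context {R : realType}.

Definition separable (T : topologicalType) :=
  exists2 S : set T, countable S & dense S.

(* A Hilbert space is a complete normed module whose norm is the one of the
   inner product ip. *)
Definition norm_from_dot (H : completeNormedModType R)
    (ip : {dot H for idfun}) :=
  forall x : H, (`|x| ^+ 2 = ip x x)%R.

Definition weakly_converges (X : normedModType R) (u : nat -> X) (x : X) :=
  forall f : {linear X -> R^o}, continuous f -> f (u n) @[n --> \oo] --> f x.

Definition seq_weakly_precompact (X : normedModType R) (A : set X) :=
  forall u : nat -> X, (forall n, A (u n)) ->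
  exists (phi : nat -> nat) (x : X),
    increasing_seq phi /\ weakly_converges (u \o phi) x.

(* In \bar R, 0 * +oo = 0: at the endpoints t = 0, 1 the inequality is trivial,
   whether or not J is finite. *)
Definition convex_ext (X : lmodType R) (J : X -> \bar R) :=
  forall (u v : X) (t : R), (0 <= t <= 1)%R ->
    J (t *: u + (1 - t) *: v)%R <= t%:E * J u + (1 - t)%:E * J v.

(* J has values in R + {+oo} and a nonempty domain. *)
Definition proper (X : Type) (J : X -> \bar R) :=
  (forall u, -oo < J u) /\ (exists u, J u < +oo).

End Spaces.

Section Problem.
Context {R : realType} {X : completeNormedModType R}
  {H : completeNormedModType R}.
Variables (ip : {dot H for idfun}) (K : X -> H) (J : X -> \bar R).

Definition basic_assumptions :=
  [/\ separable X, norm_from_dot ip, continuous K,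
      [/\ convex_ext J, lower_semicontinuous J & proper J] &
      forall (h : H) (c : R), (0 < c)%R ->
        seq_weakly_precompact [set u | (`|K u - h| ^+ 2)%:E + J u <= c%:E]].

Definition is_solution (g : H) (ud : X) :=
  [/\ K ud = g, J ud < +oo & forall u, K u = g -> J ud <= J u].

Definition alm_objective (tau : R) (p gd : H) (u : X) : \bar R :=
  (tau / 2 * `|K u - gd| ^+ 2)%:E + J u - (ip p (K u - gd)%R)%:E.

(* The iterates are u 1, u 2, ... and p 0 = p0, p 1, ...; u 0 is irrelevant.
   The minimizer need not be unique: any selection is allowed. *)
Definition is_alm (tau : nat -> R) (gd p0 : H) (u : nat -> X) (p : nat -> H) :=
  p 0%N = p0 /\
  forall k : nat,
    (forall v, alm_objective (tau k.+1) (p k) gd (u k.+1)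
               <= alm_objective (tau k.+1) (p k) gd v) /\
    (p k.+1 = p k + tau k.+1 *: (gd - K (u k.+1)))%R.

End Problem.

Definition step_sum {R : realType} (tau : nat -> R) (n : nat) : R :=
  (\sum_(1 <= k < n.+1) tau k)%R.

Section IndexFunctions.
Context {R : realType}.
Implicit Types (Phi : R -> R) (s t y : R).

(* Only the restriction of Phi to [0, +oo[ matters. *)
Definition index_function Phi :=
  [/\ Phi 0%R = 0%R,
      {within `[0%R, +oo[, continuous Phi},
      {in `[0%R, +oo[ &, {homo Phi : x y / (x < y)%R}} &
      convex_function (E := R^o) `[0%R, +oo[ (fun x => - Phi x)%R].

(* Since Phi is injective on [0, +oo[, the set below has at most one element;
   as ereal_inf set0 = +oo, the value outside the range of Phi is +oo. *)
Definition index_inv Phi t : \bar R :=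
  ereal_inf [set x%:E | x in [set x : R | (0 <= x)%R /\ Phi x = t]].

Definition index_conj Phi s : \bar R :=
  ereal_sup [set (s * t)%:E - index_inv Phi t | t in [set t : R | (0 <= t)%R]].

(* Inverse function of Psi := index_conj Phi, at y > 0. Psi is convex with
   Psi 0 = 0, so each value y > 0 is taken at most once on [0, +oo[, and where
   it is taken this is the inverse (index_conj_invK). The only index functions
   for which Psi takes no positive finite value are the linear ones
   Phi t = c * t, where Psi jumps from 0 to +oo at 1 / c; the inverse is then
   read as the point of the jump. *)
Definition index_conj_inv Phi y : R :=
  sup [set s : R | (0 <= s)%R /\ index_conj Phi s <= y%:E].

Lemma index_inv_ge0 Phi t : 0 <= index_inv Phi t.
Proof. by apply: le_ereal_inf_tmp => _ [x [x0 _] <-]; rewrite lee_fin. Qed.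

Lemma index_conj_invK Phi s y :
  (0 <= s)%R -> (0 < y)%R -> index_conj Phi s = y%:E ->
  index_conj_inv Phi y = s.
Proof.
move=> s0 y0 Psis.
have ubs : ubound [set r : R | (0 <= r)%R /\ index_conj Phi r <= y%:E] s.
  move=> r [r0 Psir]; rewrite leNgt; apply/negP => sr.
  have r_gt0 : (0 < r)%R by exact: le_lt_trans sr.
  have sr1 : (s / r < 1)%R by rewrite ltr_pdivrMr// mul1r.
  have sr0 : (0 <= s / r)%R by rewrite divr_ge0// ltW.
  have : index_conj Phi s <= (s / r * y)%:E.
    apply: ge_ereal_sup => _ [t t0 <-].
    have : (r * t)%:E - index_inv Phi t <= y%:E.
      by apply: le_trans Psir; apply: ereal_sup_ubound; exists t.
    have := index_inv_ge0 Phi t.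
    case: (index_inv Phi t) => [i| |]; last by [].
      rewrite lee_fin => i0; rewrite -!EFinB !lee_fin => rt.
      have -> : (s * t = s / r * (r * t))%R.
        by rewrite mulrA divfK// gt_eqF.
      apply: (@le_trans _ _ (s / r * (r * t - i))%R); last exact: ler_wpM2l.
      by rewrite mulrBr lerD2l lerN2 ler_piMl// ltW.
    by move=> _ _; rewrite addeNy leNye.
  by rewrite Psis lee_fin leNgt gtr_pMl// sr1.
apply/le_anti/andP; split.
  by apply: ge_sup => //; exists s; split; rewrite ?Psis.
by apply: ub_le_sup; [exists s | split; rewrite ?Psis].
Qed.

End IndexFunctions.

Definition variational_inequality {R : realType}
    {X H : completeNormedModType R} (K : X -> H) (J : X -> \bar R) (g : H)
    (ud : X) (D : X -> X -> \bar R) (Phi : R -> R) :=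
  [/\ index_function Phi,
      forall u v, 0 <= D u v,
      forall u, D u u = 0,
      is_solution K J g ud &
      forall u, D u ud <= J u - J ud + (Phi (`|K u - g| ^+ 2)%R)%:E].

(* Admissible bound B for the norms of the initial values p0: the estimates of
   the theorem are false for p0 <> 0 if Phi is allowed to be o(sqrt t) at 0.
   Take X = H = R, K = id, J = 0, D = 0, g = ud = 0, Phi t = t, tau_k = 16,
   gd = 0: then u_1 = p0 / 16, whereas Psi (16 / t_1) = Psi 1 = 0, so that
   (p0 / 16)^2 <= C * delta^2 would have to hold for all delta > 0.
   By convexity of J, the second alternative holds automatically unless ud is
   a minimizer of J over all of X. *)
Definition initial_bound {R : realType} (Phi : R -> R) (B : R) :=
  B = 0%R \/
  exists2 c : R, (0 < c)%R &
    \forall t \near (0%R : R)^'+, (c * Num.sqrt t <= Phi t)%R.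

(* Main.v *)
Require Import Defs.
From HB Require Import structures.
From mathcomp Require Import all_boot all_order all_algebra.
From mathcomp Require Import all_classical all_reals all_analysis.
From mathcomp Require Import ring lra.
Import Order.TTheory GRing.Theory Num.Theory.
Import numFieldNormedType.Exports.
Local Open Scope classical_set_scope.
Local Open Scope ring_scope.
Local Open Scope ereal_scope.

(** The iterates [p k] of the augmented Lagrangian method are proximal point
iterates for the dual functional [G p = J^*(K^* p) - <p, gd>], with subgradient
[K (u k) - gd] at [p k]. Gueler's estimate for the proximal point method bounds
[|p n| / t] and [|K (u n) - gd|], where [t = step_sum tau n], by [|q| / t] and
[|p0| / t] for an almost minimal point [q] of the dual functional regularised by
[|q| ^ 2 / (2 t)]. By duality [q = t (gd - K v)], with [v] an almost minimiser
of [J + t / 2 * |K u - gd| ^ 2]; comparing [v] with [ud], the variational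
inequality and Young's inequality [(16 / t) Phi x <= x + Psi (16 / t)] give
[|q| ^ 2 <= 2 t ^ 2 (Psi (16 / t) + delta ^ 2)]. Finally
[J (u n) - J ud <= <p n, K (u n) - g>], so the variational inequality at [u n]
turns these bounds into a bound for [D (u n) ud].

For the asymptotic statement the same argument is run with [L * t] instead of
[t] in the regularisation, where [L] is so large that [16 / (L * t)] is smaller
than the inverse of [Psi] at [delta ^ 2]: [Psi] need not be doubling, so
[Psi (16 / t)] itself may fail to be [O(delta ^ 2)]. *)

(** * Inner products: bilinearity and Young's inequality *)

Section DotProduct.
Local Open Scope ring_scope.
Context {R : realType} {H : lmodType R} (ip : {dot H for idfun}).
Implicit Types (t : R) (x y z : H).

Lemma dotC x y : ip x y = ip y x.
Proof. by rewrite hermC expr0 mul1r. Qed.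

Lemma dotDr x y z : ip x (y + z) = ip x y + ip x z.
Proof. exact: linearDr. Qed.

Lemma dotBr x y z : ip x (y - z) = ip x y - ip x z.
Proof. exact: linearBr. Qed.

Lemma dotZr t x y : ip x (t *: y) = t * ip x y.
Proof. exact: linearZr_LR. Qed.

Lemma dotDl x y z : ip (y + z) x = ip y x + ip z x.
Proof. by rewrite dotC dotDr !(dotC x). Qed.

Lemma dotBl x y z : ip (y - z) x = ip y x - ip z x.
Proof. by rewrite dotC dotBr !(dotC x). Qed.

Lemma dotZl t x y : ip (t *: y) x = t * ip y x.
Proof. by rewrite dotC dotZr (dotC x). Qed.

Definition dotE := (dotBr, dotBl, dotDr, dotDl, dotZr, dotZl).

Lemma dot_ge0 x : 0 <= ip x x.
Proof.
by have [->|x0] := eqVneq x 0; [rewrite linear0r | rewrite ltW// neq0_dnorm_gt0].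
Qed.

Lemma dot_young t x y : 2 * t * ip x y <= ip x x + t ^+ 2 * ip y y.
Proof. have := dot_ge0 (x - t *: y); rewrite !dotE (dotC y x); lra. Qed.

Lemma dot_sum_le x y : ip (x + y) (x + y) <= 2 * ip x x + 2 * ip y y.
Proof. have := dot_young 1 x y; rewrite !dotE (dotC y x); lra. Qed.

Lemma dot_sub_le x y : ip (x - y) (x - y) <= 2 * ip x x + 2 * ip y y.
Proof. have := dot_young (-1) x y; rewrite !dotE (dotC y x); lra. Qed.

End DotProduct.

(** * Partial sums of the step sizes *)

Lemma step_sumS {R : realType} (tau : nat -> R) (n : nat) :
  (step_sum tau n.+1 = step_sum tau n + tau n.+1)%R.
Proof. by rewrite /step_sum big_nat_recr. Qed.

Lemma step_sum_ge0 {R : realType} (tau : nat -> R) (n : nat) :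
  (forall k, (1 <= k)%N -> 0 < tau k)%R -> (0 <= step_sum tau n)%R.
Proof.
by move=> tau0; rewrite /step_sum big_nat sumr_ge0// => k /andP[k1 _]; exact/ltW/tau0.
Qed.

Lemma step_sum_ge_first {R : realType} (tau : nat -> R) (n : nat) :
  (forall k, (1 <= k)%N -> 0 < tau k)%R -> (1 <= n)%N ->
  (tau 1%N <= step_sum tau n)%R.
Proof.
case: n => // n tau0 _; elim: n => [|n IH].
  by rewrite step_sumS /step_sum big_geq// add0r.
by rewrite step_sumS; have := tau0 n.+2 isT; lra.
Qed.

(** * Gueler's estimate for the proximal point method *)

(* [p] is a sequence of proximal steps for a convex function G whose
   subgradient at [p k] is [- s k]; the value of G at [p k] is
   [- ip (p k) (s k) - j k], and [q] is a comparison point at which G is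
   bounded from below by its tangents only up to the error [eta]. *)
Section ProximalPoint.
Local Open Scope ring_scope.
Context {R : realType} {H : lmodType R} (ip : {dot H for idfun}).
Variables (tau : nat -> R) (p s : nat -> H) (j : nat -> R).
Hypothesis tau_gt0 : forall k, (1 <= k)%N -> 0 < tau k.
Hypothesis pS : forall k, p k.+1 = p k + tau k.+1 *: s k.+1.
Hypothesis subgrad : forall i k,
  j i.+1 >= j k.+1 + ip (p k.+1) (s k.+1 - s i.+1).

(** Adding [subgrad] in both orders gives [ip (p k.+2 - p k.+1) (s k.+2 - s k.+1) <= 0], and the
    first factor is a positive multiple of [s k.+2]. *)
Lemma residual_nonincreasing k :
  ip (s k.+2) (s k.+2) <= ip (s k.+1) (s k.+1).
Proof.
have h1 := subgrad k k.+1; have h2 := subgrad k.+1 k.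
have : 0 <= tau k.+2 * ip (s k.+2) (s k.+1 - s k.+2).
  by move: h1 h2; rewrite (pS k.+1) !dotE; lra.
rewrite pmulr_rge0 ?tau_gt0// dotBr.
by have := dot_young ip 1 (s k.+2) (s k.+1); lra.
Qed.

(** Induction on [n]. With [u] the new step and [t] the old sum, [|s n.+2| ^ 2] collects [u ^ 2]
    from expanding [|q - p n.+1| ^ 2], [2 t u] from the decrease of G, and [t ^ 2] from
    [residual_nonincreasing]: in total [(t + u) ^ 2]. *)
Lemma prox_estimate (q z : H) (jq eta : R) (n : nat) :
  (forall k, (k <= n)%N -> j k.+1 >= jq + ip q (z - s k.+1) - eta) ->
  let t := step_sum tau n.+1 in
  2 * t * (- ip (p n.+1) (s n.+1) - j n.+1 + ip q z + jq)
  <= ip (q - p 0%N) (q - p 0%N) - ip (q - p n.+1) (q - p n.+1)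
     - t ^+ 2 * ip (s n.+1) (s n.+1) + 2 * t * eta.
Proof.
elim: n => [|n IH] hq /=.
  rewrite step_sumS /step_sum big_geq// add0r.
  have := ler_wpM2l (ltW (tau_gt0 1 isT)) (hq 0%N isT).
  have := pS 0; set a := p 1%N => ->.
  rewrite !dotE (dotC ip q (p 0%N)) (dotC ip (s 1%N) q) (dotC ip (s 1%N) (p 0%N)); lra.
have {IH} := IH (fun k kn => hq k (leqW kn)).
have := ler_wpM2l (ltW (tau_gt0 n.+2 isT)) (hq n.+1 (leqnn _)).
rewrite (step_sumS _ n.+1) /=.
have := ler_wpM2l (step_sum_ge0 tau n.+1 tau_gt0) (subgrad n.+1 n).
have := ler_wpM2l (sqr_ge0 (step_sum tau n.+1)) (residual_nonincreasing n).
have := pS n.+1; set a := p n.+2 => ->.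
move: (step_sum tau n.+1) (tau n.+2) => t u.
rewrite !dotE (dotC ip q (p n.+1)) (dotC ip (s n.+2) q) (dotC ip (s n.+2) (p n.+1)); lra.
Qed.

End ProximalPoint.

(** * The conjugate of an index function *)

Section Conjugate.
Context {R : realType}.
Implicit Types (Phi : R -> R) (r s t x : R).

Lemma index_function_ge0 Phi x : index_function Phi -> (0 <= x -> 0 <= Phi x)%R.
Proof.
move=> [Phi0 _ incr _]; rewrite le_eqVlt => /orP[/eqP <-|x0]; first by rewrite Phi0.
by rewrite -Phi0 ltW// incr// in_itv/= ?lexx ?ltW.
Qed.

Lemma index_conj_young Phi s x : index_function Phi -> (0 <= x)%R ->
  (s * Phi x - x)%:E <= index_conj Phi s.
Proof.
move=> hPhi x0.
apply: (@le_trans _ _ ((s * Phi x)%:E - index_inv Phi (Phi x))).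
  by rewrite EFinB leeB// ereal_inf_lbound//; exists x.
by apply: ereal_sup_ubound; exists (Phi x) => //=; exact: index_function_ge0 _ _ hPhi _.
Qed.

Lemma index_conj_ge0 Phi s : index_function Phi -> 0 <= index_conj Phi s.
Proof.
move=> hPhi; have [Phi0 _ _ _] := hPhi.
by have := index_conj_young _ s _ hPhi (lexx 0%R); rewrite Phi0 mulr0 subr0.
Qed.

Lemma index_conj_nondecreasing Phi r s : (r <= s)%R ->
  index_conj Phi r <= index_conj Phi s.
Proof.
move=> rs; apply: ge_ereal_sup => _ [t t0 <-].
apply: (@le_trans _ _ ((s * t)%:E - index_inv Phi t)).
  by rewrite leeB// lee_fin ler_wpM2r.
by apply: ereal_sup_ubound; exists t.
Qed.

(* Under [c * sqrt t <= Phi t] near [0], the conjugate is bounded from below by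
   a multiple of [s ^+ 2], so that [t ^+ 2 * Psi (16 / t)] stays away from [0]. *)
Lemma initial_bound_conj Phi (B T : R) :
  index_function Phi -> initial_bound Phi B -> (0 < T)%R ->
  exists2 A : R, (0 <= A)%R & forall t psi : R, (T <= t)%R ->
    index_conj Phi (16 / t) = psi%:E -> (B ^+ 2 <= A * (t ^+ 2 * psi))%R.
Proof.
move=> hPhi hB T0; case: hB => [->|[c c0 near_c]].
  by exists 0%R => // t psi _ _; rewrite expr0n mul0r.
move: near_c => /nbhs_ballP[e /= e0 he].
have hc x : (0 < x -> x < e -> c * Num.sqrt x <= Phi x)%R.
  by move=> x0 xe; apply: he => //=; rewrite /ball/= sub0r normrN gtr0_norm.
pose r : R := (Num.min 1 e / 2)%R.
have r0 : (0 < r)%R by rewrite divr_gt0// lt_min ltr01.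
have r1 : (r <= 1 / 2)%R by rewrite ler_pM2r// ge_min lexx.
have re : (r <= e / 2)%R by rewrite ler_pM2r// ge_min lexx orbT.
clearbody r.
(* Young's inequality is tested at [x = (h * s) ^+ 2]: [h <= c / 2] keeps [c h s ^ 2 - h ^ 2 s ^ 2]
   above [h ^ 2 s ^ 2], and [h <= r T / 16] puts [x] below [e] whenever [t >= T]. *)
pose h : R := (Num.min (c / 2) (r * T / 16))%R.
have h0 : (0 < h)%R by rewrite lt_min !divr_gt0 ?mulr_gt0.
have hc2 : (h <= c / 2)%R by rewrite ge_min lexx.
have hrT : (h <= r * T / 16)%R by rewrite ge_min lexx orbT.
exists (B ^+ 2 / (16 * h) ^+ 2)%R => [|t psi Tt Psit].
  by rewrite divr_ge0 ?sqr_ge0.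
have t0 : (0 < t)%R by exact: lt_le_trans Tt.
pose s : R := (16 / t)%R.
have s0 : (0 < s)%R by rewrite divr_gt0 ?ltr0n.
have hs_gt0 : (0 < h * s)%R by rewrite mulr_gt0.
have hsr : (h * s <= r)%R.
  rewrite /s mulrA ler_pdivrMr//.
  have := ler_wpM2l (ltW r0) Tt; lra.
have hs2e : ((h * s) ^+ 2 < e)%R.
  by have := ler_wpM2l (ltW hs_gt0) (le_trans hsr r1); lra.
have hs20 : (0 < (h * s) ^+ 2)%R by rewrite exprn_gt0.
have := index_conj_young _ s _ hPhi (ltW hs20).
rewrite Psit lee_fin => psi_ge.
have := hc _ hs20 hs2e; rewrite sqrtr_sqr gtr0_norm// => Phi_ge.
have psi_ge' : (h ^+ 2 * s ^+ 2 <= psi)%R.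
  have := ler_wpM2l (ltW s0) Phi_ge.
  have : (h * (h * s ^+ 2) <= c / 2 * (h * s ^+ 2))%R.
    by rewrite ler_wpM2r// mulr_ge0 ?sqr_ge0// ltW.
  lra.
have st : (s * t = 16)%R by rewrite divfK// gt_eqF.
have : ((16 * h) ^+ 2 <= t ^+ 2 * psi)%R.
  have := ler_wpM2l (sqr_ge0 t) psi_ge'.
  have -> : (t ^+ 2 * (h ^+ 2 * s ^+ 2) = h ^+ 2 * (s * t) ^+ 2)%R by ring.
  by rewrite st; lra.
move=> le_psi; rewrite mulrAC ler_pdivlMr ?exprn_gt0 ?mulr_gt0//.
by rewrite ler_wpM2l ?sqr_ge0.
Qed.

(** If the set has no supremum, [sup] is the default 0, contradicting [0 <= r]; otherwise it
    contains some [s > r], and the conjugate is monotone. *)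
Lemma index_conj_le_lt_inv Phi r y : (0 <= r)%R -> (r < index_conj_inv Phi y)%R ->
  index_conj Phi r <= y%:E.
Proof.
rewrite /index_conj_inv; set S := (S in sup S) => r0 rsup.
have hs : has_sup S.
  by apply: contrapT => /sup_out sup0; move: rsup; rewrite sup0 ltNge r0.
have eps0 : (0 < sup S - r)%R by rewrite subr_gt0.
have [s [_ Psis]] := sup_adherent eps0 hs.
rewrite subKr => rs; apply: le_trans Psis.
by apply: index_conj_nondecreasing; exact: ltW.
Qed.

End Conjugate.

(** * Optimality conditions for the iterates *)

Section AugmentedLagrangian.
Context {R : realType} {X H : completeNormedModType R}.
Variables (ip : {dot H for idfun}) (K : {linear X -> H}) (J : X -> \bar R).
Hypotheses (normE : norm_from_dot ip) (J_convex : convex_ext J)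
  (J_proper : Defs.proper J).

Lemma proper_fineK u : J u < +oo -> (fine (J u))%:E = J u.
Proof. by move=> Ju; rewrite fineK// fin_numElt Ju (proj1 J_proper). Qed.

Lemma alm_objectiveE (t : R) (p gd : H) u : J u < +oo ->
  alm_objective ip K J t p gd u =
  (t / 2 * ip (K u - gd) (K u - gd) + fine (J u) - ip p (K u - gd))%R%:E.
Proof. by move=> Ju; rewrite /alm_objective -(proper_fineK _ Ju) normE. Qed.

Section Minimizer.
Variables (t : R) (p gd : H) (x : X) (eps : R).
Hypothesis x_min : forall v,
  alm_objective ip K J t p gd x <= alm_objective ip K J t p gd v + eps%:E.

Lemma minimizer_finite : J x < +oo.
Proof.
have [J_gtN [v Jv]] := J_proper.
have := x_min v; rewrite (alm_objectiveE _ _ _ _ Jv) /alm_objective.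
by have := J_gtN x; case: (J x).
Qed.

(** Compare [x] with [l *: v + (1 - l) *: x] and divide by [l]. The weight [l] stays free: for
    [eps = 0] it can tend to 0, for almost minimizers it balances [eps / l] against the quadratic
    remainder. *)
Lemma minimizer_subgradient (l : R) v : (0 < l <= 1)%R -> J v < +oo ->
  (fine (J x) + ip (p + t *: (gd - K x)) (K v - K x) - eps / l
   - l * (t / 2 * ip (K v - K x) (K v - K x)) <= fine (J v))%R.
Proof.
move=> /andP[l0 l1] Jv; have Jx := minimizer_finite.
have l01 : (0 <= l <= 1)%R by rewrite ltW.
have := J_convex v x _ l01.
rewrite -(proper_fineK _ Jv) -(proper_fineK _ Jx) -!EFinM -EFinD => Jw.
have Jw_fin : J (l *: v + (1 - l) *: x)%R < +oo by exact: le_lt_trans Jw (ltry _).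
move: Jw; rewrite -(proper_fineK _ Jw_fin) lee_fin => Jw.
have := x_min (l *: v + (1 - l) *: x)%R.
rewrite !alm_objectiveE// -EFinD lee_fin.
have -> : (K (l *: v + (1 - l) *: x) - gd = (K x - gd) + l *: (K v - K x))%R.
  by rewrite linearD !linearZ/= scalerBl scale1r scalerBr addrCA addrAC.
move: (fine (J _)) Jw => jw Jw.
have -> : (gd - K x = - (K x - gd))%R by rewrite opprB.
move: (K x - gd)%R (K v - K x)%R => a b.
rewrite !dotE (dotC ip b a) linearNl => hmin.
rewrite -(ler_pM2l l0).
have ll : (l * (eps / l) = eps)%R by rewrite mulrC divfK// gt_eqF.
lra.
Qed.

End Minimizer.
Lemma alm_iterate_finite (tau : nat -> R) (gd p0 : H) u p k :
  is_alm ip K J tau gd p0 u p -> J (u k.+1) < +oo.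
Proof.
move=> [_ /(_ k)[umin _]].
by apply: (@minimizer_finite (tau k.+1) (p k) gd _ 0%R) => v; rewrite adde0.
Qed.

(** The case [eps = 0] with [l] tending to 0; it is what makes [p] a proximal sequence in the sense
    of [subgrad]. *)
Lemma alm_subgradient (tau : nat -> R) (gd p0 : H) u p k v :
  (0 < tau k.+1)%R -> is_alm ip K J tau gd p0 u p -> J v < +oo ->
  (fine (J (u k.+1)) + ip (p k.+1) (K v - K (u k.+1)) <= fine (J v))%R.
Proof.
move=> tau0 [_ /(_ k)[umin ->]] Jv; apply/ler_addgt0Pr => e e0.
set c := (tau k.+1 / 2 * ip (K v - K (u k.+1)) (K v - K (u k.+1)))%R.
have c0 : (0 <= c)%R by rewrite mulr_ge0 ?dot_ge0// divr_ge0// ltW.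
pose l := Num.min 1%R (e / (c + 1))%R.
have l0 : (0 < l)%R by rewrite lt_min ltr01 divr_gt0// ltr_wpDl.
have l1 : (l <= 1)%R by rewrite ge_min lexx.
have lc : (l * (c + 1) <= e)%R.
  by rewrite -ler_pdivlMr ?ltr_wpDl// ge_min lexx orbT.
have uq w : alm_objective ip K J (tau k.+1) (p k) gd (u k.+1)
    <= alm_objective ip K J (tau k.+1) (p k) gd w + 0%:E by rewrite adde0.
have l01 : (0 < l <= 1)%R by rewrite l0.
have := minimizer_subgradient _ _ _ _ _ uq _ _ l01 Jv.
by rewrite mul0r subr0 -/c; lra.
Qed.

Lemma dot_self_le (x : H) (r : R) : (`|x| <= r)%R -> (ip x x <= r ^+ 2)%R.
Proof. by move=> xr; rewrite -normE lerXn2r ?nnegrE// (le_trans _ xr). Qed.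

(** * Estimates from the variational inequality *)

Section VariationalInequality.
Variables (g : H) (ud : X) (D : X -> X -> \bar R) (Phi : R -> R).
Hypothesis hVI : variational_inequality K J g ud D Phi.

Lemma Phi_le (t psi b : R) : (0 < t)%R -> index_conj Phi (16 / t) = psi%:E ->
  (0 <= b)%R -> (Phi b <= t / 16 * (b + psi))%R.
Proof.
have [hPhi _ _ _ _] := hVI => t0 Psit b0.
have := index_conj_young _ (16 / t)%R _ hPhi b0.
rewrite Psit lee_fin -(@ler_pM2l _ (t / 16)%R) ?divr_gt0//.
have -> : (t / 16 * (16 / t * Phi b - b) = Phi b - t / 16 * b)%R.
  by field; rewrite gt_eqF.
lra.
Qed.

Lemma variational_lower_bound u : J u < +oo ->
  (fine (J ud) <= fine (J u) + Phi (ip (K u - g) (K u - g)))%R.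
Proof.
have [_ D0 _ [_ Jud _] hD] := hVI => Ju.
have := le_trans (D0 _ _) (hD u).
rewrite normE -(proper_fineK _ Ju) -(proper_fineK _ Jud) -EFinB -EFinD lee_fin.
lra.
Qed.

(* Strong duality without existence of minimizers: [t *: (gd - K v)], with [v]
   almost minimal for the penalised functional, plays the role of a minimizer of
   the Tikhonov-regularised dual functional. *)
Lemma almost_dual_minimizer (t delta psi eta : R) (gd : H) (w : nat -> X) n :
  (0 < t)%R -> (0 < delta)%R -> (`|g - gd| <= delta)%R ->
  index_conj Phi (16 / t) = psi%:E -> (0 < eta)%R ->
  (forall k, J (w k) < +oo) ->
  exists v, [/\ J v < +oo,
    (ip (gd - K v) (gd - K v) <= 2 * (psi + delta ^+ 2))%R &
    forall k, (k <= n)%N ->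
      (fine (J v) + ip (t *: (gd - K v)) (K (w k) - K v) - eta
       <= fine (J (w k)))%R].
Proof.
move=> t0 delta0 hgd Psit eta0 Jw.
have [hPhi _ _ [Kud Jud _] _] := hVI.
have psi0 : (0 <= psi)%R by rewrite -lee_fin -Psit index_conj_ge0.
have hgd2 := dot_self_le _ _ hgd.
have delta2 : (0 < delta ^+ 2)%R by rewrite exprn_gt0.
pose F u := (t / 2 * ip (K u - gd) (K u - gd) + fine (J u))%R.
have FE u : J u < +oo -> alm_objective ip K J t 0%R gd u = (F u)%:E.
  by move=> Ju; rewrite alm_objectiveE// linear0l subr0.
(* The 16 in [Phi_le] makes [Phi] cost only [t / 8] of the penalty weight [t / 2], leaving
   [3 / 8 * t]. *)
have F_ge u : J u < +oo ->
    (fine (J ud) - t / 8 * delta ^+ 2 - t / 16 * psi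
     + 3 / 8 * t * ip (K u - gd) (K u - gd) <= F u)%R.
  move=> Ju; have := variational_lower_bound _ Ju.
  have := Phi_le _ _ _ t0 Psit (dot_ge0 ip (K u - g)).
  have : (ip (K u - g) (K u - g)
      <= 2 * ip (K u - gd) (K u - gd) + 2 * delta ^+ 2)%R.
    have := dot_sub_le ip (K u - gd) (g - gd).
    by rewrite opprB addrA subrK; lra.
  move=> h; have := ler_wpM2l (ltW t0) h; rewrite /F; lra.
pose S := [set F u | u in [set u | J u < +oo]].
have infS : has_inf S.
  split; first by exists (F ud), ud.
  exists (fine (J ud) - t / 8 * delta ^+ 2 - t / 16 * psi)%R => _ [u /= Ju <-].
  apply: le_trans (F_ge u Ju).
  by rewrite lerDl mulr_ge0 ?dot_ge0// mulr_ge0 ?ltW.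
(* [v] will depend on [eps], hence on [l] and [M]; so [M] bounds the quadratic remainder, for all
   [k <= n], through the a priori bound [Kv] alone. *)
pose M := (t / 2 * (2 * (\sum_(i < n.+1) ip (K (w i) - gd) (K (w i) - gd))
                    + 4 * (psi + delta ^+ 2)) + 1)%R.
have sum0 : (0 <= \sum_(i < n.+1) ip (K (w i) - gd) (K (w i) - gd))%R.
  by apply: sumr_ge0 => i _; exact: dot_ge0.
have M0 : (0 < M)%R.
  rewrite ltr_wpDl// mulr_ge0 ?divr_ge0 ?(ltW t0)// addr_ge0 ?mulr_ge0//.
  by rewrite addr_ge0// ltW.
pose l := Num.min 1%R (eta / (2 * M))%R.
have l0 : (0 < l)%R by rewrite lt_min ltr01 divr_gt0// mulr_gt0.
have l1 : (l <= 1)%R by rewrite ge_min lexx.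
have lM : (l * (2 * M) <= eta)%R.
  by rewrite -ler_pdivlMr ?mulr_gt0// ge_min lexx orbT.
(* The first entry secures the factor 2 in [Kv]; the second leaves half of [eta] for the quadratic
   remainder. *)
pose eps := Num.min (t / 16 * delta ^+ 2)%R (eta / 2 * l)%R.
have eps0 : (0 < eps)%R by rewrite lt_min !mulr_gt0.
have epst : (eps <= t / 16 * delta ^+ 2)%R by rewrite ge_min lexx.
have epsl : (eps / l <= eta / 2)%R by rewrite ler_pdivrMr// ge_min lexx orbT.
have [_ [v /= Jv <-] Fv] := inf_adherent eps0 infS.
have v_min u : J u < +oo -> (F v <= F u + eps)%R.
  move=> Ju; apply/ltW/(lt_le_trans Fv); rewrite lerD2r.
  by apply: ge_inf; [exact: infS.2 | exists u].
have Fud : (F ud <= fine (J ud) + t / 2 * delta ^+ 2)%R.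
  by rewrite /F Kud addrC lerD2l ler_wpM2l// divr_ge0// ltW.
have Kv : (ip (K v - gd) (K v - gd) <= 2 * (psi + delta ^+ 2))%R.
  rewrite -(ler_pM2l t0).
  have := F_ge v Jv; have := v_min ud Jud.
  have := mulr_ge0 (ltW t0) psi0; have := mulr_gt0 t0 delta2; lra.
exists v; split=> //.
  by rewrite -opprB linearNl linearNr opprK.
move=> k kn.
have v_min' u : alm_objective ip K J t 0%R gd v
    <= alm_objective ip K J t 0%R gd u + eps%:E.
  rewrite FE//; have [Ju|] := ltP (J u) (+oo).
    by rewrite FE// -EFinD lee_fin v_min.
  by rewrite leye_eq => /eqP Ju; rewrite /alm_objective Ju leey.
have l01 : (0 < l <= 1)%R by rewrite l0.
have := minimizer_subgradient _ _ _ _ _ v_min' _ _ l01 (Jw k).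
rewrite add0r.
suff : (l * (t / 2 * ip (K (w k) - K v) (K (w k) - K v)) <= eta / 2)%R by lra.
have : (t / 2 * ip (K (w k) - K v) (K (w k) - K v) <= M)%R.
  rewrite -[leLHS]addr0 lerD// ler_wpM2l ?divr_ge0 ?(ltW t0)//.
  have := dot_sub_le ip (K (w k) - gd) (K v - gd).
  rewrite opprB addrA subrK => h; apply: (le_trans h).
  have : (ip (K (w k) - gd) (K (w k) - gd)
      <= \sum_(i < n.+1) ip (K (w i) - gd) (K (w i) - gd))%R.
    rewrite (bigD1 (Ordinal (kn : (k < n.+1)%N)))//= lerDl sumr_ge0// => i _.
    exact: dot_ge0.
  lra.
by move=> /(ler_wpM2l (ltW l0)); lra.
Qed.

(** Replacing [t] by [T = L * t] in the comparison point costs only powers of [L] in [C], as the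
    right side of [prox_estimate] is of order [T ^ 2 * W]. *)
Lemma alm_estimate (tau : nat -> R) (B L : R) :
  (forall k, (1 <= k)%N -> 0 < tau k)%R -> initial_bound Phi B -> (1 <= L)%R ->
  exists2 C : R, (0 < C)%R &
    forall (delta : R) (gd p0 : H) u p n psi,
      (0 < delta)%R -> (`|g - gd| <= delta)%R -> (`|p0| <= B)%R ->
      is_alm ip K J tau gd p0 u p -> (1 <= n)%N ->
      index_conj Phi (16 / (L * step_sum tau n)) = psi%:E ->
      D (u n) ud <= (C * step_sum tau n * (psi + delta ^+ 2))%:E
      /\ (`|K (u n) - gd| ^+ 2 <= C * (psi + delta ^+ 2))%R.
Proof.
move=> tau0 hB L1; have [hPhi _ _ [Kud Jud _] hD] := hVI.
have L0 : (0 < L)%R by exact: lt_le_trans L1.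
have [A A0 hA] := initial_bound_conj _ _ _ hPhi hB (tau0 1%N isT).
pose N := (10 + 2 * A)%R.
have N0 : (0 < N)%R by rewrite ltr_pwDl// mulr_ge0.
exists (L * (5 + 2 * N + 2 * (N * L ^+ 2)))%R.
  by rewrite mulr_gt0// !addr_gt0// !mulr_gt0// exprn_gt0.
move=> delta gd p0 u p [//|n] psi delta0 hgd hp0 hu _ Psit.
have tau1 := step_sum_ge_first tau n.+1 tau0 isT.
set t := step_sum tau n.+1 in Psit tau1 *.
have t0 : (0 < t)%R by exact: lt_le_trans (tau0 1%N isT) tau1.
pose T := (L * t)%R; rewrite -/T in Psit.
have tT : (t <= T)%R by rewrite ler_peMl// ltW.
have T0 : (0 < T)%R by exact: lt_le_trans tT.
have psi0 : (0 <= psi)%R by rewrite -lee_fin -Psit index_conj_ge0.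
have delta2 : (0 < delta ^+ 2)%R by rewrite exprn_gt0.
set W := (psi + delta ^+ 2)%R.
have W0 : (0 < W)%R by rewrite ltr_wpDl.
have Ju k : J (u k.+1) < +oo := alm_iterate_finite _ _ _ _ _ k hu.
have eta0 : (0 < T * delta ^+ 2)%R by rewrite mulr_gt0.
have [v [Jv hz hv]] := almost_dual_minimizer _ _ _ _ _ (fun k => u k.+1) n
  T0 delta0 hgd Psit eta0 Ju.
pose s k := (gd - K (u k))%R.
have sE k x : (K x - K (u k) = s k - (gd - K x))%R.
  by rewrite /s opprB [RHS]addrC subrKA.
have pS k : (p k.+1 = p k + tau k.+1 *: s k.+1)%R by have [_ /(_ k)[]] := hu.
have sub i k : (fine (J (u k.+1)) + ip (p k.+1) (s k.+1 - s i.+1)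
    <= fine (J (u i.+1)))%R.
  by rewrite -sE; exact: (alm_subgradient _ _ _ _ _ k _ (tau0 k.+1 isT) hu (Ju i)).
have subv := alm_subgradient _ _ _ _ _ n _ (tau0 n.+1 isT) hu Jv.
rewrite sE in subv.
set z := (gd - K v)%R in hz hv subv.
have hv' k : (k <= n)%N ->
    (fine (J v) + ip (T *: z) (z - s k.+1) - T * delta ^+ 2
     <= fine (J (u k.+1)))%R.
  move=> kn; have -> : (z - s k.+1 = K (u k.+1) - K v)%R.
    by rewrite /z /s opprB [LHS]addrC subrKA.
  exact: hv.
clearbody z.
have := prox_estimate ip tau p s (fun k => fine (J (u k))) tau0 pS sub
  _ _ _ _ _ hv'.
rewrite -/t /=.
have -> : p 0%N = p0 by have [] := hu.
set a := (T *: z - p n.+1)%R => est.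
have TW0 : (0 < T ^+ 2 * W)%R by rewrite mulr_gt0// exprn_gt0.
have hq : (ip (T *: z) (T *: z) <= 2 * (T ^+ 2 * W))%R.
  rewrite !dotE; have := ler_wpM2l (sqr_ge0 T) hz; rewrite -/W; lra.
have hp02 : (ip p0 p0 <= A * (T ^+ 2 * W))%R.
  apply: le_trans (dot_self_le _ _ hp0) _.
  apply: le_trans (hA _ _ (le_trans tau1 tT) Psit) _.
  by rewrite ler_wpM2l// ler_wpM2l ?sqr_ge0// lerDl ltW.
have hdelta : (t * (T * delta ^+ 2) <= T ^+ 2 * W)%R.
  apply: (@le_trans _ _ (T * (T * delta ^+ 2))%R); first by rewrite ler_wpM2r// ltW.
  by rewrite mulrA -expr2 ler_wpM2l ?sqr_ge0// lerDr.
have hqp0 := dot_sub_le ip (T *: z) p0.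
have tz : (t ^+ 2 * ip z z <= ip (T *: z) (T *: z))%R.
  by rewrite !dotE mulrA -expr2 ler_wpM2r ?dot_ge0// ler_sqr// nnegrE ltW.
(* By [subv] the left side of [est] is at least [2 t * ip a z], which Young absorbs into
   [|a| ^ 2 / 2 + 2 t ^ 2 |z| ^ 2]. With [q = T *: z], what remains is
   [4 |q| ^ 2 + 2 |p0| ^ 2 + 2 T ^ 2 W], whence [N]. *)
have core : (ip a a / 2 + t ^+ 2 * ip (s n.+1) (s n.+1) <= N * (T ^+ 2 * W))%R.
  have := dot_young ip (- (2 * t)) a z.
  have := ler_wpM2l (ltW t0) subv.
  have -> : (ip a z = ip (T *: z) z - ip (p n.+1) z)%R by rewrite dotBl.
  rewrite dotBr /N; lra.
have hs : (ip (s n.+1) (s n.+1) <= N * L ^+ 2 * W)%R.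
  rewrite -(@ler_pM2l _ (t ^+ 2)%R) ?exprn_gt0//.
  by have := dot_ge0 ip a; move: core; rewrite /T exprMn; lra.
have hp : (ip (p n.+1) (p n.+1) <= (4 + 4 * N) * (T ^+ 2 * W))%R.
  have := dot_sub_le ip (T *: z) a; rewrite /a subKr -/a.
  by have := dot_ge0 ip (s n.+1); have := sqr_ge0 t => t2 /(mulr_ge0 t2); lra.
pose b := ip (K (u n.+1) - g)%R (K (u n.+1) - g)%R.
have hb : (b <= (2 * (N * L ^+ 2) + 2) * W)%R.
  have := dot_sum_le ip (s n.+1) (g - gd).
  have -> : (s n.+1 + (g - gd) = g - K (u n.+1))%R by rewrite addrC subrKA.
  rewrite -(opprB _ g) linearNl linearNr opprK -/b.
  have := dot_self_le _ _ hgd.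
  have : (delta ^+ 2 <= W)%R by rewrite lerDr.
  lra.
have NL0 : (0 < N * L ^+ 2)%R by rewrite mulr_gt0// exprn_gt0.
split; last first.
  rewrite distrC normE (le_trans hs)// ler_wpM2r ?(ltW W0)//.
  apply: (@le_trans _ _ (1 * (5 + 2 * N + 2 * (N * L ^+ 2)))%R); first lra.
  by rewrite ler_wpM2r//; lra.
apply: le_trans (hD _) _.
rewrite -(proper_fineK _ (Ju n)) -(proper_fineK _ Jud) normE -/b.
rewrite -EFinB -EFinD lee_fin.
have := Phi_le _ _ b T0 Psit (dot_ge0 _ _).
have := alm_subgradient _ _ _ _ _ n _ (tau0 n.+1 isT) hu Jud.
rewrite Kud -opprB linearNr.
have := dot_young ip T (p n.+1) (K (u n.+1) - g); rewrite -/b => young.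
have : (ip (p n.+1) (K (u n.+1) - g) <= (2 + 2 * N) * (T * W) + T * b / 2)%R.
  rewrite -(@ler_pM2l _ (2 * T)%R) ?mulr_gt0//; lra.
have := ler_wpM2l (ltW T0) hb.
have : (0 <= T * (N * L ^+ 2 * W))%R by rewrite !mulr_ge0// ltW.
have : (0 <= T * W)%R by rewrite mulr_ge0// ltW.
have : (T * psi <= T * W)%R by rewrite ler_wpM2l ?(ltW T0)// lerDl ltW.
have -> : (L * (5 + 2 * N + 2 * (N * L ^+ 2)) * t * W
  = (5 + 2 * N) * (T * W) + 2 * (T * (N * L ^+ 2 * W)))%R by rewrite /T; ring.
lra.
Qed.

End VariationalInequality.
End AugmentedLagrangian.

(** * Nonasymptotic estimates and convergence rates *)

Theorem theorem3p2 (R : realType) (X H : completeNormedModType R)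
    (ip : {dot H for idfun}) (K : {linear X -> H}) (J : X -> \bar R)
    (g : H) (ud : X) (D : X -> X -> \bar R) (Phi : R -> R)
    (tau : nat -> R) (B : R)
    (hbasic : basic_assumptions ip K J)
    (hVI : variational_inequality K J g ud D Phi)
    (htau : forall k : nat, (1 <= k)%N -> (0 < tau k)%R)
    (htsum : step_sum tau n @[n --> \oo] --> +oo%R)
    (hB : initial_bound Phi B) :
  (exists2 C : R, (0 < C)%R &
    forall (delta : R) (gd p0 : H) (u : nat -> X) (p : nat -> H),
      (0 < delta)%R -> (`|g - gd| <= delta)%R -> (`|p0| <= B)%R ->
      is_alm ip K J tau gd p0 u p ->
      forall n : nat, (1 <= n)%N ->
        D (u n) ud <= (C * step_sum tau n)%:E
          * (index_conj Phi (16 / step_sum tau n)%R + (delta ^+ 2)%:E)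
        /\ (`|K (u n) - gd| ^+ 2)%:E <= C%:E
          * (index_conj Phi (16 / step_sum tau n)%R + (delta ^+ 2)%:E))
  /\
  (forall a b : R, (0 < a)%R -> (0 < b)%R ->
    exists2 M : R, (0 < M)%R &
    \forall delta \near (0%R : R)^'+,
    forall (gd p0 : H) (u : nat -> X) (p : nat -> H) (n : nat),
      (`|g - gd| <= delta)%R -> (`|p0| <= B)%R ->
      is_alm ip K J tau gd p0 u p -> (1 <= n)%N ->
      (a / index_conj_inv Phi (delta ^+ 2) <= step_sum tau n
        <= b / index_conj_inv Phi (delta ^+ 2))%R ->
        D (u n) ud <= (M * (delta ^+ 2 / index_conj_inv Phi (delta ^+ 2)))%:E
        /\ (`|K (u n) - g| ^+ 2 <= M * delta ^+ 2)%R).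
Proof.
have [_ normE _ [J_convex _ J_proper] _] := hbasic.
have [hPhi _ _ _ _] := hVI.
have step_gt0 n : (1 <= n)%N -> (0 < step_sum tau n)%R.
  by move=> n1; apply: lt_le_trans (htau 1%N isT) (step_sum_ge_first _ _ htau n1).
split.
  have [C C0 hC] := alm_estimate ip K J normE J_convex J_proper
    _ _ _ _ hVI _ _ _ htau hB (lexx 1%R).
  exists C => // delta gd p0 u p delta0 hgd hp0 hu n n1.
  have t0 := step_gt0 n n1.
  have := index_conj_ge0 _ (16 / step_sum tau n)%R hPhi.
  case E : (index_conj _ _) => [psi| |] // _.
    rewrite -EFinD -!EFinM !lee_fin.
    by apply: hC hgd hp0 hu n1 _ => //; rewrite mul1r.
  (* An infinite conjugate makes both right sides infinite. *)
  by rewrite addye// !gt0_muley ?lte_fin ?mulr_gt0// !leey.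
move=> a b a0 b0.
(* From [t >= a / sigma] this gives [16 / (L * t) <= sigma / 2], hence the strict inequality
   [r_lt]. *)
pose L := Num.max 1%R (32 / a)%R.
have L1 : (1 <= L)%R by rewrite le_max lexx.
have La : (32 <= L * a)%R by rewrite -ler_pdivrMr// le_max lexx orbT.
have [C C0 hC] := alm_estimate ip K J normE J_convex J_proper
  _ _ _ _ hVI _ _ _ htau hB L1.
have Cb : (0 < C * b)%R by rewrite mulr_gt0.
exists (2 * (C * b) + (4 * C + 2))%R; first lra.
near=> delta => gd p0 u p n hgd hp0 hu n1 /andP[].
have delta0 : (0 < delta)%R by near: delta; exact: nbhs_right_gt.
have delta2 : (0 < delta ^+ 2)%R by rewrite exprn_gt0.
set sigma := index_conj_inv _ _; set t := step_sum tau n => ta tb.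
have t0 : (0 < t)%R := step_gt0 n n1.
(* The quotients vanish if [sigma] takes the junk value [0]. *)
have sigma0 : (0 < sigma)%R.
  by rewrite -invr_gt0 -(pmulr_rgt0 _ b0); exact: lt_le_trans tb.
have Lt0 : (0 < L * t)%R by rewrite mulr_gt0// (lt_le_trans _ L1).
have r0 : (0 <= 16 / (L * t))%R by rewrite divr_ge0// ltW.
have r_lt : (16 / (L * t) < sigma)%R.
  rewrite ltr_pdivrMr//; apply: (@lt_le_trans _ _ 32%R); first lra.
  apply: le_trans La _; rewrite mulrCA ler_pM2l ?(lt_le_trans _ L1)//.
  by rewrite mulrC -ler_pdivrMr.
have := index_conj_le_lt_inv _ _ _ r0 r_lt.
have := index_conj_ge0 _ (16 / (L * t))%R hPhi.
case E : (index_conj _ _) => [psi| |] //; rewrite !lee_fin => psi0 psi_le.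
have [D_le K_le] := hC _ _ _ _ _ _ _ delta0 hgd hp0 hu n1 E.
have delta_sigma : (0 < delta ^+ 2 / sigma)%R by rewrite divr_gt0.
split.
  apply: le_trans D_le _; rewrite lee_fin.
  apply: (@le_trans _ _ (2 * (C * b) * (delta ^+ 2 / sigma))%R); last first.
    by rewrite ler_wpM2r ?ltW//; lra.
  apply: (@le_trans _ _ (C * (b / sigma) * (2 * delta ^+ 2))%R).
    apply: ler_pM; [by rewrite ltW// mulr_gt0// divr_gt0 | by rewrite addr_ge0// ltW | | lra].
    by rewrite ler_wpM2l// ltW.
  by rewrite le_eqVlt; apply/orP; left; apply/eqP; ring.
have := dot_sub_le ip (K (u n) - gd)%R (g - gd)%R.
rewrite opprB addrA subrK -!normE.
have : (`|g - gd| ^+ 2 <= delta ^+ 2)%R.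
  by rewrite normE; exact: dot_self_le.
have : (C * (psi + delta ^+ 2) <= C * (2 * delta ^+ 2))%R.
  by rewrite ler_pM2l//; lra.
have := mulr_gt0 Cb delta2.
lra.
Unshelve. all: by end_near.
Qed.
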